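(* Let $X\in\mathcal{C}_1$ be a circular graph containing at least one particle of each type, i.e. there is a vertex $u$ of $X$ with $a_1(u)=1$ and there is a vertex $v$ of $X$ with $b_1(v)=1$. For $n\in\mathbb{N}$ let $u_n=|V\left((\sqrt{\tau}\, I)^n(X)\right)|$. Then $(u_n)=\Theta((\sqrt{n}))$.
   Context: Names. Let $\mathbb{K}$ be a countable set. Names are terms $u,v ::= c \mid u.t \mid u\vee v$ with $c\in\mathbb{K}$, $t\in\{l,r\}^*$, modulo the equalities $(u\vee v).l=u$, $(u\vee v).r=v$, $u.\varepsilon=u$, $u.l\vee u.r=u$ ($\varepsilon$ the empty word). Circular graphs. An element $X$ of $\mathcal{C}_1$ consists of a finite nonempty set $V(X)$ of names such that for all $v,v'\in V(X)$ and $t,t'\in\{l,r\}^*$, $v.t=v'.t'$ implies $v=v'$ and $t=t'$; a set $E(X)$ of edges; and two bits $a_1(u),b_1(u)\in\{0,1\}$ for each vertex $u$. Each vertex $u$ has two ports $u:a$ and $u:b$; each edge has the form $\{u:b,v:a\}$, every port of every vertex belongs to exactly one edge, and the graph is connected, i.e. it is a single finite cycle (a one-vertex cycle has the single edge $\{u:b,u:a\}$). If $\{u:b,v:a\}\in E(X)$, think of $v$ as the right neighbour of $u$. The bit $a_1(u)=1$ (resp. $b_1(u)=1$) means that $u$ contains a particle about to move along port $a$ (resp. port $b$); these are the two types of particles. Step $\sqrt{\tau}$ (each particle hops by half an edge along its port; edges become vertices and vertices become edges). $V(\sqrt{\tau}(X))=\{u.r\vee v.l \mid \{u:b,v:a\}\in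 E(X)\}$; for each $u\in V(X)$ with right neighbour $x$ and left neighbour $y$ (i.e. $\{u:b,x:a\},\{y:b,u:a\}\in E(X)$), there is an edge $\{y':b,x':a\}$ with $y'=y.r\vee u.l$ and $x'=u.r\vee x.l$; and the vertex $x'=u.r\vee v.l$ coming from the edge $\{u:b,v:a\}$ has bits $b_1(x')=b_1(u)$ and $a_1(x')=a_1(v)$. Step $I$. Synchronously everywhere in the graph: (split) every vertex $u$ with $a_1(u)=b_1(u)=1$ is replaced by two vertices $u.l,u.r$ joined by the edge $\{u.l:b,u.r:a\}$, where $u.l$ inherits the connection of port $a$ of $u$ and $u.r$ inherits the connection of port $b$ of $u$, with $a_1(u.l)=b_1(u.r)=1$ and $b_1(u.l)=a_1(u.r)=0$; (merge) every pair of vertices $u,v$ with $\{u:b,v:a\}\in E(X)$, $a_1(u)=b_1(v)=1$ and $b_1(u)=a_1(v)=0$ is replaced by one vertex $u\vee v$ with $a_1(u\vee v)=b_1(u\vee v)=1$, which inherits the connection of port $a$ of $u$ and the connection of port $b$ of $v$. Everything else is unchanged. These patterns do not overlap, and $I$ is an involution. $\sqrt{\tau}\,I:\mathcal{C}_1\to\mathcal{C}_1$ is the composition applying $I$ first and then $\sqrt{\tau}$. For real sequences, $(u_n)=\Theta((v_n))$ means that there exist positive reals $a,b$ and $n_0\in\mathbb{N}$ such that for all $n\ge n_0$, $a\,v_n\le u_n\le b\,v_n$. *)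

(* Defs.v *)
From HB Require Import structures.
From mathcomp Require Import all_boot all_order all_algebra finmap.
From mathcomp Require Import generic_quotient.
From mathcomp Require Import boolp reals.

Set Implicit Arguments.
Unset Strict Implicit.
Unset Printing Implicit Defensive.

Import Order.TTheory GRing.Theory Num.Theory.

(* Words over {l, r}: l is false and r is true. *)
Definition word := seq bool.

Inductive term (K : Type) : Type :=
| Cst of K
| Dot of term K & word
| Or of term K & term K.

Section TermCountable.
Variable K : countType.

Fixpoint term_encode (u : term K) : GenTree.tree (K + word) :=
  match u with
  | Cst c => GenTree.Leaf (inl c)
  | Dot u t => GenTree.Node 0 [:: term_encode u; GenTree.Leaf (inr t)]
  | Or u v => GenTree.Node 1 [:: term_encode u; term_encode v]
  end.

Fixpoint term_decode (x : GenTree.tree (K + word)) : option (term K) :=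
  match x with
  | GenTree.Leaf (inl c) => Some (Cst c)
  | GenTree.Node 0 [:: x; GenTree.Leaf (inr t)] =>
      omap (fun u => Dot u t) (term_decode x)
  | GenTree.Node 1 [:: x; y] =>
      if term_decode x is Some u then omap (Or u) (term_decode y) else None
  | _ => None
  end.

Lemma term_encodeK : pcancel term_encode term_decode.
Proof. by elim=> [c|u /= -> t|u /= -> v ->]. Qed.

HB.instance Definition _ := Countable.copy (term K) (pcan_type term_encodeK).

End TermCountable.

(* The rule [eqv_cat] says that u.t for a word t is the iterated application
   of its letters; without it (u \/ v).(lr) = u.r could not be derived. *)
Inductive term_eqv (K : Type) : term K -> term K -> Prop :=
| eqv_refl u : term_eqv u u
| eqv_sym u v : term_eqv u v -> term_eqv v u
| eqv_trans u v w : term_eqv u v -> term_eqv v w -> term_eqv u w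
| eqv_congr_dot u v t : term_eqv u v -> term_eqv (Dot u t) (Dot v t)
| eqv_congr_or u u' v v' :
    term_eqv u u' -> term_eqv v v' -> term_eqv (Or u v) (Or u' v')
| eqv_cat u s t : term_eqv (Dot (Dot u s) t) (Dot u (s ++ t))
| eqv_nil u : term_eqv (Dot u [::]) u
| eqv_or_l u v : term_eqv (Dot (Or u v) [:: false]) u
| eqv_or_r u v : term_eqv (Dot (Or u v) [:: true]) v
| eqv_or_eta u : term_eqv (Or (Dot u [:: false]) (Dot u [:: true])) u.

Section Names.
Variable K : countType.

Definition term_eqvb (u v : term K) : bool := `[< term_eqv u v >].

Lemma term_eqvb_refl : reflexive term_eqvb.
Proof. by move=> u; apply/asboolP; apply: eqv_refl. Qed.

Lemma term_eqvb_sym : symmetric term_eqvb.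
Proof. by move=> u v; apply/asboolP/asboolP; apply: eqv_sym. Qed.

Lemma term_eqvb_trans : transitive term_eqvb.
Proof.
move=> v u w /asboolP uv /asboolP vw; apply/asboolP; exact: eqv_trans uv vw.
Qed.

Canonical term_eqv_equiv :=
  EquivRel term_eqvb term_eqvb_refl term_eqvb_sym term_eqvb_trans.

Definition name := {eq_quot term_eqvb}%qT.

HB.instance Definition _ := Choice.on name.

Definition cst (c : K) : name := (\pi_name (Cst c))%qT.
Definition dot (u : name) (t : word) : name := (\pi_name (Dot (repr u) t))%qT.
Definition join (u v : name) : name := (\pi_name (Or (repr u) (repr v)))%qT.

Lemma name_piP (u v : term K) :
  (\pi_name u = \pi_name v)%qT <-> term_eqv u v.
Proof.
by split=> [/eqmodP /asboolP //|uv]; apply/eqmodP; apply/asboolP.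
Qed.

Lemma repr_pi (u : term K) : term_eqv (repr (\pi_name u)%qT) u.
Proof. by apply/name_piP; rewrite reprK. Qed.

Lemma dot_pi (u : term K) t : dot (\pi_name u)%qT t = (\pi_name (Dot u t))%qT.
Proof. by apply/name_piP; apply: eqv_congr_dot; apply: repr_pi. Qed.

Lemma join_pi (u v : term K) :
  join (\pi_name u)%qT (\pi_name v)%qT = (\pi_name (Or u v))%qT.
Proof. by apply/name_piP; apply: eqv_congr_or; apply: repr_pi. Qed.

Lemma dot_cat (u : name) s t : dot (dot u s) t = dot u (s ++ t).
Proof. by rewrite -[u]reprK (dot_pi (repr u) s) !dot_pi; apply/name_piP; apply: eqv_cat. Qed.

Lemma dot_nil (u : name) : dot u [::] = u.
Proof. by rewrite -[u]reprK dot_pi; apply/name_piP; apply: eqv_nil. Qed.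

Lemma dot_join_l (u v : name) : dot (join u v) [:: false] = u.
Proof.
by rewrite -[u]reprK -[v]reprK join_pi dot_pi; apply/name_piP; apply: eqv_or_l.
Qed.

Lemma dot_join_r (u v : name) : dot (join u v) [:: true] = v.
Proof.
by rewrite -[u]reprK -[v]reprK join_pi dot_pi; apply/name_piP; apply: eqv_or_r.
Qed.

Lemma join_dot (u : name) : join (dot u [:: false]) (dot u [:: true]) = u.
Proof.
by rewrite -[u]reprK !dot_pi join_pi; apply/name_piP; apply: eqv_or_eta.
Qed.

Definition lft (u : name) : name := dot u [:: false].
Definition rgt (u : name) : name := dot u [:: true].

End Names.

(* The pair (u, v) in [edges] stands for the edge {u:b, v:a}; [parta] (resp.
   [partb]) is the set of vertices u such that a_1(u) = 1 (resp. b_1(u) = 1). *)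
Record graph (K : countType) := Graph {
  verts : {fset name K};
  edges : {fset name K * name K};
  parta : {fset name K};
  partb : {fset name K}
}.

Section Circular.
Variable K : countType.
Implicit Types (X : graph K) (u v : name K) (e : name K * name K).
Local Open Scope fset_scope.

Definition a1 X u : bool := u \in parta X.
Definition b1 X u : bool := u \in partb X.

Definition adjacent X : rel (verts X) :=
  fun x y => ((val x, val y) \in edges X) || ((val y, val x) \in edges X).

Record circular X : Prop := Circular {
  circ_nonempty : verts X != fset0;
  circ_names : forall u v (s t : word), u \in verts X -> v \in verts X ->
    dot u s = dot v t -> u = v /\ s = t;
  circ_edges : forall e, e \in edges X -> e.1 \in verts X /\ e.2 \in verts X;
  circ_port_a : forall v, v \in verts X -> exists! u, (u, v) \in edges X;
  circ_port_b : forall u, u \in verts X -> exists! v, (u, v) \in edges X;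
  circ_connected : forall u v : verts X, connect (@adjacent X) u v;
  circ_parta : parta X `<=` verts X;
  circ_partb : partb X `<=` verts X
}.

(* The maps below are total on [graph K] but only meant for circular graphs,
   on which neighbours are unique and the default value u is never used. *)
Definition right_nbr X u : name K :=
  if [pick v : verts X | (u, val v) \in edges X] is Some v then val v else u.
Definition left_nbr X u : name K :=
  if [pick v : verts X | (val v, u) \in edges X] is Some v then val v else u.

Definition edge_name e : name K := join (rgt e.1) (lft e.2).

Definition sqrt_tau X : graph K := {|
  verts := [fset edge_name e | e in edges X];
  edges := [fset (edge_name (left_nbr X u, u), edge_name (u, right_nbr X u))
             | u in verts X];
  parta := [fset edge_name e | e in edges X & a1 X e.2];
  partb := [fset edge_name e | e in edges X & b1 X e.1]
|}.

Definition splits X u : bool := a1 X u && b1 X u.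

Definition merges X e : bool :=
  [&& e \in edges X, a1 X e.1, b1 X e.2, ~~ b1 X e.1 & ~~ a1 X e.2].

Definition unchanged X u : bool :=
  [&& ~~ splits X u, ~~ merges X (u, right_nbr X u)
    & ~~ merges X (left_nbr X u, u)].

(* [heir_a X u] (resp. [heir_b X u]) is the vertex of I(X) inheriting the
   connection of port a (resp. b) of u, when it is not internal to a merge. *)
Definition heir_a X u : name K :=
  if splits X u then lft u
  else if merges X (u, right_nbr X u) then join u (right_nbr X u) else u.
Definition heir_b X u : name K :=
  if splits X u then rgt u
  else if merges X (left_nbr X u, u) then join (left_nbr X u) u else u.

Definition step_I X : graph K :=
  let splitL := [fset lft u | u in verts X & splits X u] in
  let splitR := [fset rgt u | u in verts X & splits X u] in
  let merged := [fset join e.1 e.2 | e in edges X & merges X e] in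
  {| verts := [fset u in verts X | unchanged X u]
                `|` splitL `|` splitR `|` merged;
     edges := [fset (heir_b X e.1, heir_a X e.2)
                | e in edges X & ~~ merges X e]
                `|` [fset (lft u, rgt u) | u in verts X & splits X u];
     parta := [fset u in verts X | unchanged X u && a1 X u]
                `|` splitL `|` merged;
     partb := [fset u in verts X | unchanged X u && b1 X u]
                `|` splitR `|` merged |}.

Definition sqrt_tau_I X : graph K := sqrt_tau (step_I X).

End Circular.

Local Open Scope ring_scope.

Definition Theta (R : realType) (u v : nat -> R) : Prop :=
  exists a b : R, exists n0 : nat, [/\ 0 < a, 0 < b &
    forall n, (n0 <= n)%N -> a * v n <= u n <= b * v n].

(* Main.v *)
(* Cut the cycle before every vertex carrying an a-particle, and record each
   block as the word of the b-bits of its vertices. In the frame of the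
   b-particles, sqrt(tau) moves the last letter of each block to the front of
   the next block, while I replaces 1w by 01w (split) and 01w by 1w (merge).
   A block in which a merge takes place had a merge at the previous step and
   has shrunk since, so merges stop. From then on, if z denotes the length of a
   block after I and r the sum over its ones of their distances to the end of
   the block, the sum over all blocks of z(z-1)/2 - r increases at every step
   by exactly the number q > 0 of b-particles. Since r is at most q z, the sum
   of the z^2 grows linearly in n, and the total length like sqrt(n). *)
Require Import Defs.
From mathcomp Require Import all_boot all_order all_algebra finmap.
From mathcomp Require Import reals.
From mathcomp Require Import all_fingroup zify.

Set Implicit Arguments.
Unset Strict Implicit.
Unset Printing Implicit Defensive.

Local Open Scope nat_scope.

(* The index set [J] stands for the vertices u with a_1(u) = 1, each heading a
   block that extends to the vertex before the next one. Positions (j, i) with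
   [len j <= i] carry junk names and bits. *)
Record conf (K : countType) (J : finType) := Conf {
  len : J -> nat;
  nm : J * nat -> name K;
  bt : J * nat -> bool
}.

(** * Block encoding of circular graphs *)

Section Blocks.
Variables (K : countType) (J : finType) (s : {perm J}).
Implicit Types (c : conf K J) (x y : J * nat) (j : J).

Definition valid c x : bool := x.2 < len c x.1.

Definition nxt c x : J * nat :=
  if x.2.+1 < len c x.1 then (x.1, x.2.+1) else (s x.1, 0).

Definition prv c x : J * nat :=
  if x.2 is i.+1 then (x.1, i) else (s^-1%g x.1, (len c (s^-1%g x.1)).-1).

(** The a-bits are implicit: position 0 carries an a-particle, and [1 < len c j] puts position 1 in
    the same block, where it carries none. *)
Definition merging c j : bool :=
  [&& ~~ bt c (j, 0), 1 < len c j & bt c (j, 1)].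

(** The vertex created on the edge entering [x] takes position [x]. Its a-bit comes from the right
    end of that edge, so heads remain heads, while b-bits advance by one position. *)
Definition conf_tau c := Conf (len c)
  (fun x => edge_name (nm c (prv c x), nm c x)) (fun x => bt c (prv c x)).

(* On the word of bits of a block, I acts by 1w -> 01w and 01w -> 1w, that is,
   by adding or removing an initial 0. *)
Definition conf_I c := Conf
  (fun j => if bt c (j, 0) then (len c j).+1
            else if merging c j then (len c j).-1 else len c j)
  (fun x => let: (j, i) := x in
     if bt c (j, 0) then
       match i with
       | 0 => lft (nm c (j, 0))
       | 1 => rgt (nm c (j, 0))
       | i'.+2 => nm c (j, i'.+1)
       end
     else if merging c j then
       if i is 0 then join (nm c (j, 0)) (nm c (j, 1)) else nm c (j, i.+1)
     else nm c (j, i))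
  (fun x => let: (j, i) := x in
     if bt c (j, 0) then if i is i'.+1 then bt c (j, i') else false
     else if merging c j then bt c (j, i.+1) else bt c (j, i)).

(* The position in [conf_I c] of the vertex inheriting port b; as merges and
   splits happen at the start of a block, only the head of a block can have
   another heir for port a. *)
Definition heir_pos c x : J * nat :=
  if bt c (x.1, 0) then (x.1, x.2.+1)
  else if merging c x.1 then (x.1, x.2.-1) else x.

Definition kept c x : bool :=
  if bt c (x.1, 0) then 0 < x.2
  else if merging c x.1 then 1 < x.2 else true.

Definition independent (P : J * nat -> bool) (f : J * nat -> name K) :=
  forall x y t t', P x -> P y -> dot (f x) t = dot (f y) t' -> x = y /\ t = t'.

(** [J] and [s] stay fixed during the whole evolution: blocks are never created, destroyed or
    reordered, only their contents change. *)
Record rep (X : graph K) c : Prop := Rep {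
  rep_len : forall j, 0 < len c j;
  rep_names : independent (valid c) (nm c);
  rep_verts : forall u, u \in verts X <-> exists2 x, valid c x & u = nm c x;
  rep_edges : forall e, e \in edges X <->
    exists2 x, valid c x & e = (nm c x, nm c (nxt c x));
  rep_parta : forall u, u \in parta X <-> exists j, u = nm c (j, 0);
  rep_partb : forall u, u \in partb X <->
    exists x, [/\ valid c x, bt c x & u = nm c x]
}.

(* Only nonempty suffixes need decoding, because an equality of names can be
   extended by one letter on both sides; this makes [join] harmless. *)
Lemma independent_decode (P Q : J * nat -> bool) (f g : J * nat -> name K)
    (phi : J * nat -> word -> (J * nat) * word) :
  (forall x b t, Q x -> P (phi x (b :: t)).1 /\
     dot (g x) (b :: t) = dot (f (phi x (b :: t)).1) (phi x (b :: t)).2) ->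
  (forall x y b t b' t', Q x -> Q y -> phi x (b :: t) = phi y (b' :: t') ->
     x = y /\ b :: t = b' :: t') ->
  independent P f -> independent Q g.
Proof.
move=> dec inj ind x y t t' Qx Qy e.
have: dot (g x) (rcons t true) = dot (g y) (rcons t' true).
  by rewrite -!cats1 -!dot_cat e.
case Et: (rcons t true) => [|b w]; first by case: t Et {e}.
case Et': (rcons t' true) => [|b' w']; first by case: t' Et' {e}.
have [Px ->] := dec x b w Qx; have [Py ->] := dec y b' w' Qy.
move=> /(ind _ _ _ _ Px Py) [e1 e2].
have [-> ew] := inj x y b w b' w' Qx Qy (injective_projections _ _ e1 e2).
split=> //; have: rcons t true = rcons t' true by rewrite Et Et'.
by case/rcons_inj.
Qed.

Lemma dot_join_cons (u v : name K) (b : bool) t :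
  dot (join u v) (b :: t) = dot (if b then v else u) t.
Proof.
rewrite -cat1s -dot_cat; by case: b; rewrite ?dot_join_l ?dot_join_r.
Qed.

(** * The graph operations read on blocks *)

Section Rep.
Variables (X : graph K) (c : conf K J).
Hypothesis Xc : rep X c.

Let len0 := rep_len Xc.

Lemma nxt_valid x : valid c (nxt c x).
Proof. by rewrite /nxt /valid; case: ifP => //= _; apply: len0. Qed.

Lemma prv_valid x : valid c x -> valid c (prv c x).
Proof.
by case: x => j [|i]; rewrite /valid /prv /= => h; [rewrite prednK | apply: ltnW].
Qed.

Lemma nxtK x : valid c x -> prv c (nxt c x) = x.
Proof.
case: x => j i; rewrite /valid /prv /nxt /= => h.
by case: ltnP => //= h'; rewrite permK; congr (_, _); lia.
Qed.

Lemma prvK x : valid c x -> nxt c (prv c x) = x.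
Proof.
case: x => j [|i]; rewrite /valid /prv /nxt /= => h; last by rewrite h.
by rewrite prednK // ltnn permKV.
Qed.

Lemma nm_inj x y : valid c x -> valid c y -> nm c x = nm c y -> x = y.
Proof.
move=> vx vy e; have := rep_names Xc (t := [::]) (t' := [::]) vx vy.
by rewrite !dot_nil => /(_ e) [].
Qed.

Lemma mem_verts x : valid c x -> nm c x \in verts X.
Proof. by move=> vx; apply/(rep_verts Xc); exists x. Qed.

Lemma mem_edges x : valid c x -> (nm c x, nm c (nxt c x)) \in edges X.
Proof. by move=> vx; apply/(rep_edges Xc); exists x. Qed.

Lemma a1E x : valid c x -> a1 X (nm c x) = (x.2 == 0).
Proof.
move=> vx; apply/idP/eqP.
  by case/(rep_parta Xc) => j /nm_inj ->; rewrite // /valid len0.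
by case: x vx => j i _ /= ->; apply/(rep_parta Xc); exists j.
Qed.

Lemma b1E x : valid c x -> b1 X (nm c x) = bt c x.
Proof.
move=> vx; apply/idP/idP.
  by case/(rep_partb Xc) => y [vy hy /nm_inj ->].
by move=> hx; apply/(rep_partb Xc); exists x.
Qed.

Lemma right_nbrE x : valid c x -> right_nbr X (nm c x) = nm c (nxt c x).
Proof.
move=> vx; rewrite /right_nbr; case: pickP => [v|].
  case/(rep_edges Xc) => y vy [] /(nm_inj vx vy) -> //.
by move/(_ [` mem_verts (nxt_valid x)]%fset); rewrite /= mem_edges.
Qed.

Lemma left_nbrE x : valid c x -> left_nbr X (nm c x) = nm c (prv c x).
Proof.
move=> vx; rewrite /left_nbr; case: pickP => [v|].
  case/(rep_edges Xc) => y vy [] /= -> /(nm_inj vx (nxt_valid _)) ->.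
  by rewrite nxtK.
move/(_ [` mem_verts (prv_valid vx)]%fset) => /=.
by have := mem_edges (prv_valid vx); rewrite prvK // => ->.
Qed.

Lemma rep_tau : rep (sqrt_tau X) (conf_tau c).
Proof.
split=> //=.
(* The first letter selects one half of the edge. The letter replacing it records which half, so
   [phi] is injective. *)
- pose phi x (w : word) := if w is true :: t then (x, false :: t)
    else (prv c x, true :: behead w).
  apply: (@independent_decode (valid c) _ (nm c) _ phi); last exact: (rep_names Xc).
    move=> x b t vx; rewrite /edge_name dot_join_cons /phi.
    by case: b => /=; rewrite /lft /rgt dot_cat; split=> //; apply: prv_valid.
  move=> x y [] t [] t' vx vy //= [] => [-> -> //|e ->].
  by rewrite -(prvK vx) e prvK.
- move=> u; split.
    case/imfsetP => e /= /(rep_edges Xc) [x vx ->] ->.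
    by exists (nxt c x); [apply: nxt_valid | rewrite nxtK].
  case=> x vx ->; apply/imfsetP; exists (nm c (prv c x), nm c x) => //=.
  by have := mem_edges (prv_valid vx); rewrite prvK.
- move=> e; split.
    case/imfsetP => u /= /(rep_verts Xc) [x vx ->] ->; exists x => //.
    by rewrite left_nbrE // right_nbrE // [nxt (conf_tau c) x]/(nxt c x) nxtK.
  case=> x vx ->; apply/imfsetP; exists (nm c x); first exact: mem_verts.
  by rewrite left_nbrE // right_nbrE // [nxt (conf_tau c) x]/(nxt c x) nxtK.
- move=> u; split.
    case/imfsetP => e /=; rewrite inE => /andP[/(rep_edges Xc) [x vx ->] /=].
    rewrite a1E ?nxt_valid // => h ->; exists (nxt c x).1.
    by rewrite -(eqP h) -surjective_pairing nxtK.
  case=> j ->; apply/imfsetP; exists (nm c (prv c (j, 0)), nm c (j, 0)) => //=.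
  have vj : valid c (j, 0) by apply: len0.
  rewrite inE a1E //= andbT.
  by have := mem_edges (prv_valid vj); rewrite prvK.
- move=> u; split.
    case/imfsetP => e /=; rewrite inE => /andP[/(rep_edges Xc) [x vx ->] /=].
    rewrite b1E // => h ->; exists (nxt c x).
    by split; [exact: nxt_valid | rewrite nxtK | rewrite nxtK].
  case=> x [vx h ->]; apply/imfsetP.
  exists (nm c (prv c x), nm c x) => //=; rewrite inE /= b1E ?prv_valid // h.
  by have := mem_edges (prv_valid vx); rewrite prvK // => ->.
Qed.

Lemma splitsE x : valid c x -> splits X (nm c x) = (x.2 == 0) && bt c x.
Proof. by move=> vx; rewrite /splits a1E // b1E. Qed.

(** The second vertex of a merge carries no a-particle, so it is not a head and lies in the block of
    the first one. *)
Lemma mergesE x : valid c x ->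
  merges X (nm c x, nm c (nxt c x)) = (x.2 == 0) && merging c x.1.
Proof.
move=> vx; have vn := nxt_valid x.
rewrite /merges mem_edges //= !a1E // !b1E // /merging.
case: x vx {vn} => j [|i] //= vx; rewrite /nxt /=.
by case: ltnP => //= _; rewrite ?andbF // andbT andbC.
Qed.

Lemma merges_rightE x : valid c x ->
  merges X (nm c x, right_nbr X (nm c x)) = (x.2 == 0) && merging c x.1.
Proof. by move=> vx; rewrite right_nbrE // mergesE. Qed.

Lemma merges_leftE x : valid c x ->
  merges X (left_nbr X (nm c x), nm c x) = (x.2 == 1) && merging c x.1.
Proof.
move=> vx; rewrite left_nbrE // -[in X in (_, X)](prvK vx) mergesE ?prv_valid //.
(* The vertex before a head ends its block; it also starts it only in a block of length 1, where no
   merge takes place. *)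
case: x vx => j [|i] //= vx; rewrite /merging.
by case: (len c _) => [|[|n]]; rewrite ?andbF.
Qed.

Lemma unchangedE x : valid c x -> unchanged X (nm c x) = kept c x.
Proof.
case: x => j i vx; rewrite /kept /unchanged splitsE // merges_rightE // merges_leftE //=.
rewrite /merging; case: i vx => [|[|i]] /= _; case: (bt c (j, 0)) => //=.
  by rewrite andbT; case: ifP.
by case: ifP.
Qed.

Lemma heir_aE j i : valid c (j, i) -> heir_a X (nm c (j, i)) =
  if i is 0 then nm (conf_I c) (j, 0) else nm c (j, i).
Proof.
move=> vx; rewrite /heir_a splitsE // merges_rightE // right_nbrE //=.
case: i vx => [|i] //= vx; case: ifP => // _; case: ifP => // m.
by case/and3P: m => _ lt1 _; rewrite /nxt /= lt1.
Qed.

(** The side condition excludes the first vertex of a merge, whose port b lies on the contracted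
    edge. *)
Lemma heir_bE x : valid c x -> ~~ ((x.2 == 0) && merging c x.1) ->
  heir_b X (nm c x) = nm (conf_I c) (heir_pos c x).
Proof.
case: x => j i vx /= nm0.
rewrite /heir_b splitsE // merges_leftE // left_nbrE //=.
case: i vx nm0 => [|[|i]] //= vx nm0; rewrite /heir_pos /=.
- by case h: (bt c (j, 0)); rewrite ?(negbTE nm0) /= h ?(negbTE nm0).
- case h: (bt c (j, 0)); first by rewrite /merging !h /= ?h.
  by case: ifP => m; rewrite /= h m.
- by case h: (bt c (j, 0)) => /=; rewrite ?h //; case: ifP => m; rewrite /= h m.
Qed.

Lemma heir_pos_valid x : valid c x -> ~~ ((x.2 == 0) && merging c x.1) ->
  valid (conf_I c) (heir_pos c x).
Proof.
case: x => j i; rewrite /valid /heir_pos /= => vx nm0.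
case h: (bt c (j, 0)); first by rewrite /= h.
by case: ifP nm0 => m; rewrite /= h m //; lia.
Qed.

(** Only the left half of a split vertex is missed, since its port b lies on the new edge. *)
Lemma heir_pos_onto x : valid (conf_I c) x -> ~~ ((x.2 == 0) && bt c (x.1, 0)) ->
  exists y, [/\ valid c y, ~~ ((y.2 == 0) && merging c y.1) & x = heir_pos c y].
Proof.
case: x => j i; rewrite /valid /=; case h: (bt c (j, 0)).
  case: i => [|i] //= vi _; exists (j, i); split=> //=.
    by rewrite /merging h andbF.
  by rewrite /heir_pos /= h.
case: ifP => m vi _.
  by exists (j, i.+1); split=> //=; rewrite /heir_pos /= ?h ?m //; lia.
by exists (j, i); split; rewrite //= ?m ?andbF // /heir_pos /= h m.
Qed.

Lemma kept_nm x : kept c x -> nm (conf_I c) (heir_pos c x) = nm c x.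
Proof.
case: x => j i; rewrite /kept /heir_pos /=; case h: (bt c (j, 0)).
  by case: i => //= i _; rewrite h.
case: ifP => m /=; rewrite h m //.
by case: i => [|[|i]].
Qed.

Lemma kept_bt x : kept c x -> bt (conf_I c) (heir_pos c x) = bt c x.
Proof.
case: x => j i; rewrite /kept /heir_pos /=; case h: (bt c (j, 0)).
  by rewrite /= h.
by case: ifP => m /=; rewrite h m //; case: i.
Qed.

Lemma kept_unmerged x : kept c x -> ~~ ((x.2 == 0) && merging c x.1).
Proof.
case: x => j i; rewrite /kept /=; case: ifP => h; first by case: i.
by case: ifP => m; [case: i | rewrite andbF].
Qed.

(** Away from the excluded position, [heir_pos] shifts a whole block by a constant, so it commutes
    with moving right; past the end of a block, port a of the next head goes to position 0. *)
Lemma nxt_heir x : valid c x -> ~~ ((x.2 == 0) && merging c x.1) ->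
  heir_a X (nm c (nxt c x)) = nm (conf_I c) (nxt (conf_I c) (heir_pos c x)).
Proof.
case: x => j i vx nm0.
have -> : nxt (conf_I c) (heir_pos c (j, i)) =
    if i.+1 < len c j then heir_pos c (j, i.+1) else (s j, 0).
  rewrite /nxt /heir_pos /=; case h: (bt c (j, 0)); first by rewrite /= h ltnS.
  case m: (merging c j) nm0 => nm0; rewrite /= h m //.
  by case: i vx nm0 => //= i _ _; rewrite ltn_predRL.
case: ifP => li; rewrite {1}/nxt [(j, i).2.+1 < _]li.
  have vn : valid c (j, i.+1) by [].
  rewrite heir_aE // kept_nm //= /kept /=; case: ifP => // _; case: ifP => // m.
  by case: i nm0 {vx li vn} => //=; rewrite m.
by rewrite heir_aE //; apply: len0.
Qed.

Lemma in_splitL u : u \in [fset lft v | v in verts X & splits X v]%fset <->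
  exists j, bt c (j, 0) /\ u = lft (nm c (j, 0)).
Proof.
split.
  case/imfsetP => v /=; rewrite inE => /andP[/(rep_verts Xc) [[j i] vx ->]].
  by rewrite splitsE //= => /andP[/eqP i0 h] ->; subst i; exists j.
case=> j [h ->]; have vj : valid c (j, 0) by apply: len0.
by apply/imfsetP; exists (nm c (j, 0)); rewrite // inE mem_verts // splitsE.
Qed.

Lemma in_splitR u : u \in [fset rgt v | v in verts X & splits X v]%fset <->
  exists j, bt c (j, 0) /\ u = rgt (nm c (j, 0)).
Proof.
split.
  case/imfsetP => v /=; rewrite inE => /andP[/(rep_verts Xc) [[j i] vx ->]].
  by rewrite splitsE //= => /andP[/eqP i0 h] ->; subst i; exists j.
case=> j [h ->]; have vj : valid c (j, 0) by apply: len0.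
by apply/imfsetP; exists (nm c (j, 0)); rewrite // inE mem_verts // splitsE.
Qed.

Lemma in_merged u :
  u \in [fset join e.1 e.2 | e in edges X & merges X e]%fset <->
  exists j, merging c j /\ u = join (nm c (j, 0)) (nm c (j, 1)).
Proof.
have nxt0 j : merging c j -> nxt c (j, 0) = (j, 1).
  by case/and3P => _ lt1 _; rewrite /nxt /= lt1.
split.
  case/imfsetP => e /=; rewrite inE => /andP[/(rep_edges Xc) [[j i] vx ->]].
  rewrite mergesE //= => /andP[/eqP i0 m] ->; subst i; exists j.
  by rewrite nxt0.
case=> j [m ->]; have vj : valid c (j, 0) by apply: len0.
apply/imfsetP; exists (nm c (j, 0), nm c (j, 1)) => //.
by rewrite -nxt0 // inE mem_edges // mergesE.
Qed.

Lemma rep_I : rep (step_I X) (conf_I c).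
Proof.
split.
- move=> j /=; case: ifP => // _; case: ifP => // /and3P[_ + _]; lia.
(* Halves of a split vertex decode by restoring the letter l or r; a merged vertex consumes one
   letter to choose between positions 0 and 1. *)
- pose phi x (w : word) := let: (j, i) := x in
    if bt c (j, 0) then
      match i with
      | 0 => ((j, 0), false :: w)
      | 1 => ((j, 0), true :: w)
      | i'.+2 => ((j, i'.+1), w)
      end
    else if merging c j then
      if i is 0 then (if w is b :: w' then ((j, nat_of_bool b), w') else (x, w))
      else ((j, i.+1), w)
    else (x, w).
  apply: (@independent_decode (valid c) _ (nm c) _ phi); last exact: (rep_names Xc).
    move=> [j i] b t; rewrite /valid /=; case: ifP => h.
      by case: i => [|[|i]] //=; rewrite /lft /rgt ?dot_cat.
    case: ifP => m; last by [].
    case/and3P: (m) => _ lt1 _.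
    case: i => [|i] /= vi; last by split=> //; lia.
    by rewrite dot_join_cons; case: b => /=; split=> //; lia.
  move=> [j i] [j' i'] b t b' t' _ _.
  (* Decoding stays inside a block, so both positions fall in the same case of [phi]. *)
  have phi1 jj ii bb tt : (phi (jj, ii) (bb :: tt)).1.1 = jj.
    rewrite /phi; case: ifP => _; first by case: ii => [|[|ii]].
    by case: ifP => // _; case: ii.
  move=> e; have := phi1 j i b t; rewrite e phi1 => ej; move: e.
  rewrite -ej /phi; case: ifP => h.
    by case: i => [|[|i]]; case: i' => [|[|i']] //= [] *; subst.
  case: ifP => m; last by case=> *; subst.
  case: i => [|i]; case: i' => [|i'] /= [].
  + by case: b b' => [] [] // _ ->.
  + by case: b.
  + by case: b'.
  + by move=> -> -> ->.
- move=> u; rewrite [verts _]/= !in_fsetU -!orbA; split.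
    case/or4P.
    + case/imfsetP => v /=; rewrite inE => /andP[/(rep_verts Xc) [x vx ->]].
      rewrite unchangedE // => kx ->; exists (heir_pos c x); last exact/esym/kept_nm.
      exact: heir_pos_valid (kept_unmerged kx).
    + by case/in_splitL => j [h ->]; exists (j, 0); rewrite /valid /= h.
    + case/in_splitR => j [h ->]; exists (j, 1); rewrite /valid /= h //.
      by rewrite ltnS len0.
    + case/in_merged => j [m ->]; case/and3P: (m) => /negbTE h lt1 _.
      by exists (j, 0); rewrite /valid /= h m //; lia.
  (* Apart from left halves of splits, every position is the [heir_pos] of some [y], and is then
     unchanged, a right half or a merged vertex. *)
  case=> x vx; case sp: ((x.2 == 0) && bt c (x.1, 0)).
    case: x sp {vx} => j i /= /andP[/eqP -> h] ->.
    by apply/or4P; apply: Or42; apply/in_splitL; exists j; rewrite h.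
  have [y [vy my ->]] := heir_pos_onto vx (negbT sp).
  case ky: (kept c y).
    move=> ->; apply/or4P; apply: Or41; apply/imfsetP; exists (nm c y).
      by rewrite /= inE unchangedE // ky andbT mem_verts.
    exact: kept_nm.
  case: y vy my ky {sp vx} => j i vy; rewrite /kept /heir_pos /=.
  case: ifP => [h _|h].
    case: i vy => // _ _ ->; apply/or4P; apply: Or43; apply/in_splitR; exists j.
    by rewrite /= h.
  case: ifP => // m; case: i vy => [|[|]] //= _ _ _ ->.
  by apply/or4P; apply: Or44; apply/in_merged; exists j; rewrite h m.
- move=> e; rewrite [edges _]/= in_fsetU; split.
    case/orP.
    + case/imfsetP => f /=; rewrite inE => /andP[/(rep_edges Xc) [x vx ->]].
      rewrite mergesE // => nm0 ->; exists (heir_pos c x); first exact: heir_pos_valid.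
      by rewrite heir_bE // nxt_heir.
    + case/imfsetP => v /=; rewrite inE => /andP[/(rep_verts Xc) [[j i] vx ->]].
      rewrite splitsE //= => /andP[/eqP i0 h] ->; subst i.
      by exists (j, 0); rewrite /valid /nxt /= h //= ltnS len0 /= h.
  (* An edge leaving the left half of a split is new; every other edge descends from an old edge
     that is not contracted. *)
  case=> x vx ->; apply/orP; case sp: ((x.2 == 0) && bt c (x.1, 0)).
    right; apply/imfsetP; case: x sp {vx} => j i /= /andP[/eqP -> h].
    have vj : valid c (j, 0) by apply: len0.
    exists (nm c (j, 0)); first by rewrite /= inE mem_verts // splitsE.
    by rewrite /nxt /= h ltnS len0 /= h.
  have [y [vy my ->]] := heir_pos_onto vx (negbT sp).
  left; apply/imfsetP; exists (nm c y, nm c (nxt c y)).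
    by rewrite /= inE mem_edges // mergesE.
  by rewrite heir_bE // nxt_heir.
- move=> u; rewrite [parta _]/= !in_fsetU -!orbA; split.
    case/or3P.
    + case/imfsetP => v /=; rewrite inE => /andP[/(rep_verts Xc) [[j i] vx ->]].
      rewrite unchangedE // a1E //= => /andP[+ /eqP i0] ->; subst i.
      rewrite /kept /=; case: ifP => // h; case: ifP => // m _.
      by exists j; rewrite /= h m.
    + by case/in_splitL => j [h ->]; exists j; rewrite /= h.
    + case/in_merged => j [m ->]; case/and3P: (m) => /negbTE h _ _.
      by exists j; rewrite /= h m.
  case=> j /=; case: ifP => [h ->|h].
    by apply/or3P; apply: Or32; apply/in_splitL; exists j.
  case: ifP => [m ->|m ->].
    by apply/or3P; apply: Or33; apply/in_merged; exists j.
  have vj : valid c (j, 0) by apply: len0.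
  apply/or3P; apply: Or31; apply/imfsetP; exists (nm c (j, 0)) => //=.
  by rewrite inE mem_verts // unchangedE // a1E // /kept /= h m.
- move=> u; rewrite [partb _]/= !in_fsetU -!orbA; split.
    case/or3P.
    + case/imfsetP => v /=; rewrite inE => /andP[/(rep_verts Xc) [x vx ->]].
      rewrite unchangedE // b1E // => /andP[kx bx] ->; exists (heir_pos c x).
      split; [exact: heir_pos_valid (kept_unmerged kx) | | exact/esym/kept_nm].
      by have := kept_bt kx; rewrite bx.
    + case/in_splitR => j [h ->]; exists (j, 1); rewrite /valid /= h.
      by rewrite ltnS len0.
    + case/in_merged => j [m ->]; case/and3P: (m) => /negbTE h lt1 b.
      by exists (j, 0); rewrite /valid /= h m; split=> //; lia.
  case=> x [vx bx]; have sp : ~~ ((x.2 == 0) && bt c (x.1, 0)).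
    apply/negP => /andP[]; case: x bx {vx} => j i /= bx /eqP i0 h.
    by move: bx; rewrite i0 h.
  have [y [vy my ex]] := heir_pos_onto vx sp; move: bx; rewrite ex => bx.
  case ky: (kept c y).
    move=> ->; apply/or3P; apply: Or31; apply/imfsetP; exists (nm c y).
      by rewrite /= inE unchangedE // ky b1E // -kept_bt // bx mem_verts.
    exact: kept_nm.
  case: y vy my ky {sp vx bx ex} => j i vy; rewrite /kept /heir_pos /=.
  case: ifP => [h _|h].
    case: i vy => // _ _ ->; apply/or3P; apply: Or32; apply/in_splitR; exists j.
    by rewrite /= h.
  case: ifP => // m; case: i vy => [|[|]] //= _ _ _ ->.
  by apply/or3P; apply: Or33; apply/in_merged; exists j; rewrite h m.
Qed.

Lemma card_verts : #|` verts X|%fset = \sum_j len c j.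
Proof.
pose l := [seq nm c (j, i) | j <- index_enum J, i <- iota 0 (len c j)].
have memP u : reflect (exists2 x, valid c x & u = nm c x) (u \in l).
  apply: (iffP allpairsPdep) => [[j [i [_ + ->]]]|[[j i] vx ->]].
    by rewrite mem_iota => /= h; exists (j, i).
  by exists j, i; rewrite mem_index_enum mem_iota.
have -> : \sum_j len c j = size l.
  rewrite size_allpairs_dep sumnE big_map; apply: eq_bigr => j _.
  by rewrite size_iota.
apply/perm_size/uniq_perm; first exact: fset_uniq.
  apply: allpairs_uniq_dep => [|j _|]; rewrite ?index_enum_uniq ?iota_uniq //.
  move=> [j i] [j' i'] /allpairsPdep[j1 [i1 [_ h1 [-> ->]]]].
  move=> /allpairsPdep[j2 [i2 [_ h2 [-> ->]]]] /=.
  rewrite !mem_iota /= in h1 h2.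
  by move/(nm_inj (x := (j1, i1)) (y := (j2, i2)) h1 h2) => [-> ->].
by move=> u; apply/idP/memP => /(rep_verts Xc).
Qed.
End Rep.

(** * Iterated dynamics on blocks: invariants and potentials *)

Definition conf_step c := conf_tau (conf_I c).

Lemma rep_step X c : rep X c -> rep (sqrt_tau_I X) (conf_step c).
Proof. by move/rep_I/rep_tau. Qed.

Lemma rep_iter X c n :
  rep X c -> rep (iter n (@sqrt_tau_I K) X) (iter n conf_step c).
Proof. by move=> Xc; elim: n => //= n /rep_step. Qed.

Definition ones c := \sum_j \sum_(i < len c j) bt c (j, val i).

Definition dist c := \sum_j \sum_(i < len c j) bt c (j, val i) * (len c j - i).

(** When no merge takes place, [len c j + bt c (j, 0)] is the length z of the block after I, so this
    is the sum of the z(z-1)/2. *)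
Definition tri c := \sum_j 'C(len c j + bt c (j, 0), 2).

Lemma ones_I c : ones (conf_I c) = ones c.
Proof.
apply: eq_bigr => j _; rewrite /=; case: ifP => h.
  by rewrite big_ord_recl.
case: ifP => // m; case/and3P: (m) => _ + _; case: (len c j) => //= n _.
by rewrite [RHS]big_ord_recl h.
Qed.

(** I only adds or removes a leading 0, and distances are counted from the end of the block. *)
Lemma dist_I c : dist (conf_I c) = dist c.
Proof.
apply: eq_bigr => j _; rewrite /=; case: ifP => h.
  by rewrite big_ord_recl.
case: ifP => // m; case/and3P: (m) => _ + _; case: (len c j) => //= n _.
by rewrite [RHS]big_ord_recl h.
Qed.

Lemma ones_tau c : (forall j, 0 < len c j) -> ones (conf_tau c) = ones c.
Proof.
move=> len0; rewrite /ones /=.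
have -> : \sum_j \sum_(i < len c j) bt c (j, val i) =
    \sum_j (\sum_(i < (len c j).-1) bt c (j, val i) + bt c (j, (len c j).-1)).
  apply: eq_bigr => j _; case: (len c j) (len0 j) => // n _.
  by rewrite big_ord_recr.
(* The last bit of block [s^-1 j] becomes the first bit of block [j]. *)
rewrite big_split /= [X in _ = _ + X](reindex_inj (@perm_inj _ s^-1%g)) /=.
rewrite -big_split /=; apply: eq_bigr => j _; rewrite addnC.
case: (len c j) (len0 j) => // n _.
by rewrite big_ord_recl.
Qed.

(** A bit staying in its block loses 1. A last bit leaves its block from distance 1, so it loses 1
    there too, and then gains the length of the block it enters. *)
Lemma dist_tau c : (forall j, 0 < len c j) -> dist (conf_tau c) + ones c =
  \sum_j bt c (prv c (j, 0)) * len c j + dist c.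
Proof.
move=> len0; rewrite /dist /ones -!big_split /=; apply: eq_bigr => j _.
case: (len c j) (len0 j) => // n _.
rewrite big_ord_recl /= subn0 -addnA; congr (_ + _).
rewrite !big_ord_recr /= subSnn muln1 addnA; congr (_ + _).
rewrite -big_split; apply: eq_bigr => i _ /=.
by rewrite -{2}[nat_of_bool _]muln1 -mulnDr /bump /=; congr (_ * _); case: i => /= i; lia.
Qed.

(* Every bit gets one step closer to the end of its block, except that a bit
   entering a block of length l adds l to [dist]; it also splits the head of the
   block at the next step, which adds l to [tri]. *)
Lemma tri_step c : (forall j, 0 < len c j) -> (forall j, ~~ merging c j) ->
  tri (conf_step c) + dist c = tri c + dist (conf_step c) + ones c.
Proof.
move=> len0 nm0; set d := conf_I c.
have lend j : len d j = len c j + bt c (j, 0).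
  by rewrite /= (negbTE (nm0 j)); case: (bt _ _); rewrite ?addn1 ?addn0.
have lend0 j : 0 < len d j by rewrite lend ltn_addr.
have binD n (b : bool) : 'C(n + b, 2) = 'C(n, 2) + b * n.
  by case: b; rewrite ?addn1 ?binS ?bin1 ?mul1n ?addn0.
have := dist_tau lend0; rewrite dist_I ones_I -addnA => ->.
rewrite addnA; congr (_ + _); rewrite /tri -big_split; apply: eq_bigr => j _.
rewrite -lend; exact: binD.
Qed.

(* A merge 01w -> 1w leaves 1w, and the next word of the block is a letter
   followed by 1w without its last letter; no other word produces 01w'. *)
Lemma merging_step c j : merging (conf_step c) j ->
  merging c j /\ len (conf_step c) j < len c j.
Proof.
case/and3P => _ /= + ; rewrite /prv /=.
case: (bt c (j, 0)) (erefl (bt c (j, 0))) => // h.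
case: ifP => [m _ _|_ _]; last by [].
by split=> //; case/and3P: m => _; lia.
Qed.

(** Going back in time, a merge forces a merge of the same block at every earlier step, each
    followed by a loss of length. *)
Lemma merging_iter c n j : merging (iter n conf_step c) j ->
  len (iter n conf_step c) j + n <= len c j.
Proof.
elim: n => [|n IH]; first by rewrite addn0.
case/merging_step => /IH le lt; rewrite addnS -addSn.
by apply: leq_trans le; rewrite leq_add2r.
Qed.

(** For l > 0, both binomials of l and l + 1 over 2 are at most l * l. This turns growth of [tri]
    into growth of the length. *)
Lemma tri_le c : (forall j, 0 < len c j) -> tri c <= (\sum_j len c j) ^ 2.
Proof.
move=> len0; rewrite expnS expn1 big_distrl; apply: leq_sum => j _.
have le : len c j <= \sum_j len c j by rewrite (bigD1 j) //= leq_addr.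
apply: leq_trans (_ : len c j * len c j <= _); last by rewrite leq_mul2l le orbT.
rewrite bin2; case: (bt c _); move: (len0 j); rewrite ?addn1 ?addn0 //=; nia.
Qed.

Lemma dist_le c : dist c <= ones c * \sum_j len c j.
Proof.
rewrite /ones big_distrl; apply: leq_sum => j _.
rewrite big_distrl; apply: leq_sum => i _; rewrite leq_mul2l.
by rewrite (leq_trans (leq_subr _ _)) ?orbT // (bigD1 j) //= leq_addr.
Qed.

(** The total length is at most [#|J|] times the maximal length M. With w = [ones c * #|J|] and B =
    2w + 1, the hypothesis gives M^2 <= B M + 2E, and 2 B M <= B^2 + M^2 absorbs the linear term. *)
Lemma len_quadratic c E : tri c <= dist c + E ->
  (\sum_j len c j) ^ 2 <= #|J| ^ 2 * ((2 * (ones c * #|J|) + 1) ^ 2 + 4 * E).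
Proof.
move=> triE; case: (pickP J) => [j0 _|J0]; last by rewrite big_pred0.
pose j := [arg max_(j > j0) len c j].
have jmax k : len c k <= len c j by rewrite /j; case: arg_maxnP => // i _; apply.
have L_le : \sum_j len c j <= #|J| * len c j.
  by rewrite -sum_nat_const; apply: leq_sum.
apply: leq_trans (_ : (#|J| * len c j) ^ 2 <= _); first by rewrite leq_exp2r.
rewrite expnMn leq_mul2l; apply/orP; right.
have C_le : 'C(len c j, 2) <= ones c * #|J| * len c j + E.
  apply: leq_trans (_ : tri c <= _).
    rewrite /tri (bigD1 j) //=; apply: leq_trans (leq_addr _ _).
    by apply: leq_bin2l; apply: leq_addr.
  apply: leq_trans triE _; rewrite leq_add2r; apply: leq_trans (dist_le c) _.
  by rewrite -mulnA leq_mul2l L_le orbT.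
have := bin_ffact (len c j) 2; rewrite ffactnSr ffactn1.
have := nat_Cauchy (2 * (ones c * #|J|) + 1) (len c j).
move: C_le; set C := 'C(_, _); set M := len c j; set w := ones c * _.
have -> : 2`! = 2 by [].
by case: M => [|M]; rewrite ?subn1 /=; nia.
Qed.

(** * Quadratic bounds on the total length *)

Section Growth.
Variable c : conf K J.
Hypothesis len0 : forall n j, 0 < len (iter n conf_step c) j.

Lemma ones_iter n : ones (iter n conf_step c) = ones c.
Proof.
elim: n => //= n IH; rewrite ones_tau ?ones_I // => j.
exact: (len0 n.+1).
Qed.

(** By [merging_iter], a merge at time n needs an initial block longer than n. *)
Lemma not_merging_iter n j : \sum_j len c j <= n -> ~~ merging (iter n conf_step c) j.
Proof.
move=> le; apply/negP => /merging_iter; rewrite leqNgt.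
rewrite (leq_ltn_trans (_ : _ <= n)) //.
  by apply: leq_trans le; rewrite (bigD1 j) //= leq_addr.
by rewrite -{1}[n]add0n ltn_add2r len0.
Qed.

Lemma tri_iter N m : \sum_j len c j <= N ->
  tri (iter (m + N) conf_step c) + dist (iter N conf_step c) =
  tri (iter N conf_step c) + dist (iter (m + N) conf_step c) + m * ones c.
Proof.
move=> leN; elim: m => [|m IH]; first by rewrite addn0.
have nm0 j : ~~ merging (iter (m + N) conf_step c) j.
  by apply: not_merging_iter; apply: leq_trans leN (leq_addl _ _).
have := tri_step (len0 (m + N)) nm0.
by rewrite -iterS -addSn ones_iter mulSn; lia.
Qed.

Lemma growth : 0 < #|J| -> 0 < ones c ->
  exists C N, 0 < C /\ forall n, N <= n ->
    let L := \sum_j len (iter n conf_step c) j in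
    n <= (2 * L) ^ 2 /\ L ^ 2 <= C ^ 2 * n.
Proof.
move=> p0 q0; set N := \sum_j len c j.
set cN := iter N conf_step c; set p := #|J| in p0 *; set q := ones c in q0 *.
set B := 2 * (q * p) + 1.
(* This comes from [len_quadratic] with E = n * (tri cN + q), bounding B^2 by B^2 * n. *)
pose D := p ^ 2 * (B ^ 2 + 4 * (tri cN + q)).
have D0 : 0 < D by rewrite /D muln_gt0 expn_gt0 p0 /= addn_gt0 expn_gt0 /B addn1.
(* Past this threshold [dist cN + N] is at most n / 2, so at least half of the linear growth of
   [tri] survives. *)
exists D, (2 * (dist cN + N)).+1; split=> // n len_n L.
have leNn : N <= n by lia.
have := tri_iter (n - N) (leqnn N); rewrite subnK // -/cN -/q => e; split.
  have := tri_le (len0 n); rewrite -/L expnMn.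
  have : n - N <= (n - N) * q by rewrite leq_pmulr.
  lia.
have n0 : 0 < n by apply: leq_trans len_n.
have triE : tri (iter n conf_step c) <=
    dist (iter n conf_step c) + n * (tri cN + q).
  have : (n - N) * q <= n * q by rewrite leq_mul2r leq_subr orbT.
  have : tri cN <= n * tri cN by rewrite leq_pmull.
  by rewrite mulnDr; lia.
apply: leq_trans (len_quadratic triE) _; rewrite ones_iter -/q -/p -/B.
(* Weakening [D] to its square lets the square root be taken exactly. *)
apply: leq_trans (_ : D * n <= _); last first.
  by rewrite leq_mul2r expnS expn1 leq_pmulr ?orbT.
rewrite /D -mulnA leq_mul2l mulnDl; apply/orP; right; apply: leq_add.
  by rewrite leq_pmulr.
by rewrite -mulnA [n * _]mulnC.
Qed.
End Growth.
End Blocks.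

(** * First-return map of an injection on a finite type *)

Section FirstReturn.
Variables (V : finType) (f : V -> V) (P : pred V).
Hypothesis f_inj : injective f.

(** An injective self-map of a finite type brings [x] back to itself after its order. *)
Lemma return_ex (x : {x | P x}) : exists i, (0 < i) && P (iter i f (val x)).
Proof.
by exists (fingraph.order f (val x)); rewrite fingraph.order_gt0 iter_order ?(valP x).
Qed.

Definition return_time x := ex_minn (return_ex x).

Lemma return_time_gt0 x : 0 < return_time x.
Proof. by rewrite /return_time; case: ex_minnP => i /andP[]. Qed.

Lemma return_timeP x : P (iter (return_time x) f (val x)).
Proof. by rewrite /return_time; case: ex_minnP => i /andP[]. Qed.

Lemma return_time_min x i : 0 < i -> P (iter i f (val x)) -> return_time x <= i.
Proof.
move=> i0 Pi; rewrite /return_time; case: ex_minnP => k _; apply.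
by rewrite i0.
Qed.

Definition first_return x : {x | P x} := Sub _ (return_timeP x).

(** Cancelling the i <= k common steps writes [x] as the iterate of [y] of rank k - i; if positive,
    this would be a return of [y] before its first one. *)
Lemma iter_return_inj (x y : {x | P x}) i k :
  i < return_time x -> k < return_time y ->
  iter i f (val x) = iter k f (val y) -> x = y /\ i = k.
Proof.
wlog le_ik : x y i k / i <= k.
  move=> W ix ky e; case: (leqP i k) => [|/ltnW] le; first exact: W.
  by have [-> ->] := W _ _ _ _ le ky ix (esym e).
have iter_inj m : injective (iter m f).
  by elim: m => [|m IH] a b //= /f_inj/IH.
move=> ix ky; rewrite -(subnKC le_ik) iterD => /iter_inj.
case ki: (k - i) => [|m]; first by rewrite addn0 => /val_inj.
move=> e; have : return_time y <= m.+1.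
  by apply: return_time_min; rewrite // -e (valP x).
lia.
Qed.

(** One step before the common return point, both orbits are still in the range of
    [iter_return_inj]. *)
Lemma first_return_inj : injective first_return.
Proof.
move=> x y /(congr1 val) /=.
have := return_time_gt0 x; have := return_time_gt0 y.
case ex: (return_time x) => [|i] //; case ey: (return_time y) => [|k] // _ _.
move/f_inj => e; have [] // := @iter_return_inj x y i k; rewrite ?ex ?ey //.
Qed.

Lemma iter_return_onto (x : {x | P x}) n :
  exists y i, i < return_time y /\ iter n f (val x) = iter i f (val y).
Proof.
elim: n => [|n [y [i [iy e]]]]; first by exists x, 0; rewrite return_time_gt0.
case: (leqP (return_time y) i.+1) => [ge|lt]; last first.
  by exists y, i.+1; rewrite !iterS e.
exists (first_return y), 0; rewrite return_time_gt0; split=> //=.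
by have -> : return_time y = i.+1; [lia | rewrite e].
Qed.
End FirstReturn.

(** * Block encoding of the initial graph *)

Section Initial.
Variables (K : countType) (X : graph K).
Hypothesis hX : circular X.
Let V : finType := verts X.

Definition succ (u : V) : V :=
  odflt u [pick v : V | (val u, val v) \in edges X].

Lemma succE u v : ((val u, val v) \in edges X) = (v == succ u).
Proof.
have [w [uw w_uniq]] := circ_port_b hX (valP u).
have [_ /= wV] := circ_edges hX uw.
have succP : (val u, val (succ u)) \in edges X.
  by rewrite /succ; case: pickP => // /(_ [` wV]%fset); rewrite /= uw.
apply/idP/eqP => [uv|-> //]; apply: val_inj.
exact: etrans (esym (w_uniq _ uv)) (w_uniq _ succP).
Qed.

Lemma succ_inj : injective succ.
Proof.
move=> u v e; have [w [_ w_uniq]] := circ_port_a hX (valP (succ u)).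
have eu : w = val u by apply: w_uniq; rewrite succE.
have ev : w = val v by apply: w_uniq; rewrite succE e.
by apply: val_inj; rewrite -[LHS]eu -[RHS]ev.
Qed.

(** Reachability along an injective self-map of a finite type is symmetric, so undirected paths
    reduce to forward iteration. *)
Lemma connected_succ u v : exists n, v = iter n succ u.
Proof.
suff uv : fconnect succ u v by exists (findex succ u v); rewrite iter_findex.
apply: (connect_sub _ (circ_connected hX u v)) => x y.
rewrite /adjacent !succE => /orP[] /eqP ->; first exact: fconnect1.
by rewrite (fconnect_sym succ_inj) fconnect1.
Qed.

Lemma circular_rep : (exists2 u, u \in verts X & a1 X u) ->
  exists (J : finType) (s : {perm J}) (c : conf K J), rep s X c /\ 0 < #|J|.
Proof.
case=> u0 u0V au0; pose P (u : V) := a1 X (val u).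
pose x0 : {x | P x} := Sub [` u0V]%fset au0.
pose J : finType := {x | P x}.
(* Blocks are the stretches of the cycle between consecutive a-particles: their order is the
   first-return map of [succ], their lengths are the return times. *)
exists J, (perm (@first_return_inj _ _ P succ_inj)).
exists (Conf (return_time succ_inj) (fun x : J * nat => val (iter x.2 succ (val x.1)))
  (fun x => b1 X (val (iter x.2 succ (val x.1))))).
split; last by apply/card_gt0P; exists x0.
have onto (v : V) : exists2 x : J * nat,
    x.2 < return_time succ_inj x.1 & v = iter x.2 succ (val x.1).
  have [n ->] := connected_succ (val x0) v.
  by have [y [i [iy ->]]] := iter_return_onto succ_inj x0 n; exists (y, i).
(* [nxt] depends on the lengths only, so the names and bits are dummies. *)
have nxtE (x : J * nat) : x.2 < return_time succ_inj x.1 ->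
    let y := nxt (perm (@first_return_inj _ _ P succ_inj))
      (Conf (return_time succ_inj) (fun=> u0) xpred0) x in
    iter y.2 succ (val y.1) = succ (iter x.2 succ (val x.1)).
  case: x => x i /= lt; rewrite /nxt /=; case: ltnP => //= ge.
  by rewrite permE /=; have -> : return_time succ_inj x = i.+1; [lia |].
split=> /=.
- exact: return_time_gt0.
- move=> [x i] [y k] t t' xi yk /=.
  case/(circ_names hX (valP _) (valP _)) => /val_inj e ->.
  by have [/= -> ->] := iter_return_inj xi yk e.
- move=> u; split=> [uV|[x _ ->]]; last exact: valP.
  by have [x vx e] := onto [` uV]%fset; exists x; rewrite // -e.
- move=> [u v]; split=> [uv|[x vx ->]].
    have [/= uV vV] := circ_edges hX uv.
    have [x vx e] := onto [` uV]%fset; exists x => //.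
    move: uv; rewrite -[u]/(val [` uV]%fset) -[v]/(val [` vV]%fset) succE => /eqP ->.
    by rewrite e; congr (_, val _); rewrite -(nxtE x vx).
  have := nxtE x vx; rewrite /nxt /= => ->.
  by rewrite succE.
- move=> u; split=> [au|[x ->]]; last exact: valP x.
  have uV : u \in verts X by apply: (fsubsetP (circ_parta hX)).
  by exists (Sub [` uV]%fset au).
- move=> u; split=> [bu|[x [_ bx ->]] //].
  have uV : u \in verts X by apply: (fsubsetP (circ_partb hX)).
  by have [x vx e] := onto [` uV]%fset; exists x; rewrite -e.
Qed.
End Initial.

(** * Square-root growth over the reals *)

Import GRing.Theory Num.Theory.
Local Open Scope ring_scope.

Theorem theorem1 (R : realType) (K : countType) (X : graph K)
  (hX : circular X)
  (ha : exists2 u, u \in verts X & a1 X u)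
  (hb : exists2 v, v \in verts X & b1 X v) :
  Theta (fun n : nat => #|` verts (iter n (@sqrt_tau_I K) X)|%:R : R)
        (fun n : nat => Num.sqrt (n%:R : R)).
Proof.
have [J [s [c [Xc J0]]]] := circular_rep hX ha.
have q0 : (0 < ones c)%N.
  have [v _ bv] := hb; have [[j i] [/= lt b _]] := (rep_partb Xc v).1 bv.
  by rewrite /ones (bigD1 j) //= (bigD1 (Ordinal lt)) //= b.
have [C [N [C0 bnd]]] := growth (fun n => rep_len (rep_iter n Xc)) J0 q0.
(* These constants are the square roots of n <= (2L)^2 and L^2 <= C^2 n. *)
exists 2^-1, C%:R, N; split=> [||n /bnd]; rewrite ?invr_gt0 ?ltr0n //=.
rewrite -(card_verts (rep_iter n Xc)); set L := #|` _| => -[lo up].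
have sqrtX (m : nat) : Num.sqrt ((m ^ 2)%:R : R) = m%:R.
  by rewrite natrX sqrtr_sqr ger0_norm.
apply/andP; split.
  rewrite mulrC ler_pdivrMr ?ltr0n // -natrM mulnC -[leRHS]sqrtX.
  by rewrite ler_sqrt ?ler0n // ler_nat.
rewrite -[C%:R]sqrtX -sqrtrM ?ler0n // -natrM -[L%:R]sqrtX.
by rewrite ler_sqrt ?ler0n // ler_nat.
Qed.
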